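(* Let $\mathcal{C}$ be a consequence generator, let $C$ be the canonical solution in CNF, and let $F$ be a minimal solution in CNF. If $\mathcal{C}$ is complete w.r.t. $C$, then $F\in\mathrm{SF}_{\mathcal{C}}(C)$. If $\mathcal{C}$ is well-founded, then $\mathrm{SF}_{\mathcal{C}}$ terminates on every input.
   Context: Fix a quantifier-free $F$ with free variable $x$ and a 1-grammar $U\circ V$ with $U=\{u_1,\ldots,u_m\}$, $V=\{s_1,\ldots,s_k\}$, giving the schematic extended Herbrand sequent $H = F\{x\mapsto u_1\},\ldots,F\{x\mapsto u_m\},X(\alpha)\supset\bigwedge_{j=1}^k X(s_j)\rightarrow$ (where $A\{x\mapsto t\}$ is substitution). Let $\Gamma = F\{x\mapsto u_1\},\ldots,F\{x\mapsto u_m\}$. $\alpha$ is treated as a constant, $\models$ is propositional consequence. A quantifier-free $A$ is a solution if $\Gamma, A\supset\bigwedge_{j=1}^k A\{\alpha\mapsto s_j\}\rightarrow$ is a tautology; the canonical solution is $C=\bigwedge_{i=1}^m F\{x\mapsto u_i\}$. A minimal solution is a CNF solution of minimal symbol complexity. A consequence generator $\mathcal{C}$ maps a formula $A$ to a finite set of propositional consequences; $\mathcal{C}$ generates $A$ for $B$ if $A\in\mathcal{C}(B)$ or $\mathcal{C}$ generates $A$ for some $B'\in\mathcal{C}(B)$; $\mathcal{C}$ is complete w.r.t. $A$ if for every minimal solution $B$ with $A\models B$, $\mathcal{C}$ generates $B$ for $A$; $\mathcal{C}$ is well-founded if there is a well-founded order $>$ with $\mathcal{C}(A)>\mathcal{C}(A')$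 for $A'\in\mathcal{C}(A)$. $\mathrm{SF}_{\mathcal{C}}(A)$: remove all $\alpha$-free clauses from $A$, set $S=\{A\}$, for each $B\in\mathcal{C}(A)$ such that $B\{\alpha\mapsto s_1\},\ldots,B\{\alpha\mapsto s_k\},\Gamma\rightarrow$ is valid add $\mathrm{SF}_{\mathcal{C}}(B)$ to $S$, and return $\min(S)$.
   Formalization: SF is corrected: the α-free clauses are removed only from the candidate put into S, while the loop runs over C(A) for the original A (with the stripped A both claims fail); F ∈ SF(C) is asserted whenever SF returns on C. *)

(* Defs.v *)
From HB Require Import structures.
From mathcomp Require Import all_boot all_order.
From mathcomp Require Import boolp classical_sets functions cardinality.

Set Implicit Arguments.
Unset Strict Implicit.
Unset Printing Implicit Defensive.

Local Open Scope classical_set_scope.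

Record signature := Signature {
  fsym : eqType; farity : fsym -> nat;
  psym : eqType; parity : psym -> nat }.

(* Variables are named by natural numbers. The eigenvariable alpha is one of
   them; since consequence is propositional, it behaves as a constant except
   where it is explicitly substituted. *)
Inductive term (L : signature) :=
| Var of nat
| App (f : fsym L) of {ffun 'I_(farity f) -> term L}.

Arguments Var {L}.

Inductive atom (L : signature) :=
| Pred (P : psym L) of {ffun 'I_(parity P) -> term L}.

(* Quantifier-free formulas. *)
Inductive form (L : signature) :=
| Top | Bot
| Atom of atom L
| Neg of form L
| And of form L & form L
| Or of form L & form L
| Imp of form L & form L.

Arguments Top {L}.
Arguments Bot {L}.

Section Substitution.
Variables (L : signature) (y : nat).

Fixpoint occ_term (t : term L) : bool :=
  match t with
  | Var z => z == y
  | App f a => [exists i, occ_term (a i)]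
  end.

Definition occ_atom (p : atom L) : bool :=
  let: Pred P a := p in [exists i, occ_term (a i)].

Fixpoint occ_form (A : form L) : bool :=
  match A with
  | Top | Bot => false
  | Atom p => occ_atom p
  | Neg A => occ_form A
  | And A B | Or A B | Imp A B => occ_form A || occ_form B
  end.

Variable s : term L.

Fixpoint subst_term (t : term L) : term L :=
  match t with
  | Var z => if z == y then s else Var z
  | App f a => App [ffun i => subst_term (a i)]
  end.

Definition subst_atom (p : atom L) : atom L :=
  let: Pred P a := p in Pred [ffun i => subst_term (a i)].

Fixpoint subst_form (A : form L) : form L :=
  match A with
  | Top => Top
  | Bot => Bot
  | Atom p => Atom (subst_atom p)
  | Neg A => Neg (subst_form A)
  | And A B => And (subst_form A) (subst_form B)
  | Or A B => Or (subst_form A) (subst_form B)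
  | Imp A B => Imp (subst_form A) (subst_form B)
  end.

End Substitution.

Section Semantics.
Variable L : signature.

Fixpoint eval (v : atom L -> bool) (A : form L) : bool :=
  match A with
  | Top => true
  | Bot => false
  | Atom p => v p
  | Neg A => ~~ eval v A
  | And A B => eval v A && eval v B
  | Or A B => eval v A || eval v B
  | Imp A B => eval v A ==> eval v B
  end.

Definition entails (A B : form L) : Prop := forall v, eval v A -> eval v B.

Definition equivalent (A B : form L) : Prop := forall v, eval v A = eval v B.

Definition valid_sequent (G D : seq (form L)) : Prop :=
  forall v, all (eval v) G -> has (eval v) D.

Definition bigand (G : seq (form L)) : form L := foldr (@And L) Top G.
Definition bigor (G : seq (form L)) : form L := foldr (@Or L) Bot G.

End Semantics.

(* Formulas in conjunctive normal form, up to the bracketing of conjunctions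
   and disjunctions. The literal (true, p) is p, and (false, p) is its
   negation. *)
Definition literal (L : signature) : Type := (bool * atom L)%type.
Definition clause (L : signature) : Type := seq (literal L).
Definition cnf (L : signature) : Type := seq (clause L).

Section CNF.
Variable L : signature.

Definition form_of_literal (l : literal L) : form L :=
  if l.1 then Atom l.2 else Neg (Atom l.2).
Definition form_of_clause (c : clause L) : form L :=
  bigor [seq form_of_literal l | l <- c].
Definition form_of_cnf (A : cnf L) : form L :=
  bigand [seq form_of_clause c | c <- A].

Definition occ_clause (y : nat) (c : clause L) : bool :=
  has (fun l => occ_atom y l.2) c.

Definition remove_free (alpha : nat) (A : cnf L) : cnf L :=
  [seq c <- A | occ_clause alpha c].

Fixpoint term_complexity (t : term L) : nat :=
  match t with
  | Var _ => 1
  | App f a => (\sum_i term_complexity (a i)).+1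
  end.

Definition atom_complexity (p : atom L) : nat :=
  let: Pred P a := p in (\sum_i term_complexity (a i)).+1.

Definition literal_complexity (l : literal L) : nat :=
  ~~ l.1 + atom_complexity l.2.

(* n literals are joined by n - 1 disjunctions and n clauses by n - 1
   conjunctions. The empty clause is written with one symbol, and the CNF
   without clauses with none. *)
Definition clause_complexity (c : clause L) : nat :=
  if nilp c then 1
  else \sum_(l <- c) literal_complexity l + (size c).-1.

Definition cnf_complexity (A : cnf L) : nat :=
  \sum_(c <- A) clause_complexity c + (size A).-1.

Definition min_complexity (S : set (cnf L)) : set (cnf L) :=
  [set A | S A /\ forall B, S B -> cnf_complexity A <= cnf_complexity B].

End CNF.

Coercion form_of_cnf : cnf >-> form.

Section Herbrand.
Variables (L : signature) (x alpha : nat) (F : form L) (U V : seq (term L)).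

Definition grammar_instances : seq (form L) := [seq subst_form x u F | u <- U].

Definition alpha_instances (A : form L) : seq (form L) :=
  [seq subst_form alpha s A | s <- V].

Definition solution (A : form L) : Prop :=
  valid_sequent
    (rcons grammar_instances (Imp A (bigand (alpha_instances A)))) [::].

Definition canonical_solution : form L := bigand grammar_instances.

Definition minimal_solution (A : cnf L) : Prop :=
  solution A /\
  forall B : cnf L, solution B -> cnf_complexity A <= cnf_complexity B.

Definition consequence_generator (gen : cnf L -> set (cnf L)) : Prop :=
  forall A, finite_set (gen A) /\ forall B, gen A B -> entails A B.

(* [generates gen A B]: gen generates A for B. *)
Inductive generates (gen : cnf L -> set (cnf L)) (A : cnf L) : cnf L -> Prop :=
| generates_base B : gen B A -> generates gen A B
| generates_step B B' : gen B B' -> generates gen A B' -> generates gen A B.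

Definition complete_wrt (gen : cnf L -> set (cnf L)) (A : cnf L) : Prop :=
  forall B, minimal_solution B -> entails A B -> generates gen B A.

(* [lt X Y] stands for Y > X. *)
Definition well_founded_generator (gen : cnf L -> set (cnf L)) : Prop :=
  exists lt : set (cnf L) -> set (cnf L) -> Prop,
    [/\ forall X Y Z, lt X Y -> lt Y Z -> lt X Z,
        well_founded lt &
        forall A A', gen A A' -> lt (gen A') (gen A)].

Definition keeps_solution (B : form L) : Prop :=
  valid_sequent (alpha_instances B ++ grammar_instances) [::].

(* Big-step semantics: [SF gen A S] holds when the recursive procedure called
   on A halts and returns S; since [gen A] is finite, a derivation is a finite
   tree of calls. The family R collects the values of the recursive calls.
   Removing the alpha-free clauses determines the candidate put into the
   result, while gen is applied to the argument A itself: a consequence of A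
   need not follow from A without its alpha-free clauses (P(alpha) follows
   from Q /\ (~ Q \/ P(alpha)), but not from ~ Q \/ P(alpha)). *)
Inductive SF (gen : cnf L -> set (cnf L)) : cnf L -> set (cnf L) -> Prop :=
| SF_return (A : cnf L) (R : cnf L -> set (cnf L)) :
    (forall B, gen A B -> keeps_solution B -> SF gen B (R B)) ->
    SF gen A (min_complexity
      ([set remove_free alpha A] `|`
       \bigcup_(B in [set B | gen A B /\ keeps_solution B]) R B)).

End Herbrand.

(* Main.v *)
(** Validity of the sequent that defines a solution splits into two facts: the
    instances Gamma of F entail A, and Gamma together with all A(s_j) is
    unsatisfiable. Propositional entailment is preserved by substitution,
    because evaluating A(s) under v is evaluating A under v precomposed with
    the substitution on atoms. Hence every formula B on a chain of consequences
    from the canonical solution C to M is entailed by Gamma, and the B(s_j)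
    entail the M(s_j), so SF never cuts the chain. Since Gamma entails the
    alpha-free clauses of a solution, deleting them yields again a solution;
    therefore M has none, and each candidate collected by SF is a solution, so
    not simpler than M. *)

Require Import Defs.
From HB Require Import structures.
From mathcomp Require Import all_boot all_order.
From mathcomp Require Import boolp classical_sets functions cardinality.

Set Implicit Arguments.
Unset Strict Implicit.
Unset Printing Implicit Defensive.

Section Evaluation.
Variable L : signature.
Implicit Types (v : atom L -> bool) (A B : form L) (M : cnf L).

Lemma subst_term_notin y (s t : term L) :
  ~~ occ_term y t -> subst_term y s t = t.
Proof.
(* The arguments lie inside a finite function, so the recursion is written by hand and [IHt] is
   applied to each [a i]. *)
move: t; fix IHt 1 => -[z|f a] /=; first by case: eqP.
rewrite negb_exists => /forallP a_y; congr App.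
by apply/ffunP => i; rewrite ffunE; apply: IHt.
Qed.

Lemma subst_atom_notin y (s : term L) (p : atom L) :
  ~~ occ_atom y p -> subst_atom y s p = p.
Proof.
case: p => P a /=; rewrite negb_exists => /forallP a_y; congr Pred.
by apply/ffunP => i; rewrite ffunE subst_term_notin.
Qed.

Lemma eval_subst v y s A :
  eval v (subst_form y s A) = eval (v \o subst_atom y s) A.
Proof. by elim: A => //= [A ->|A -> B ->|A -> B ->|A -> B ->]. Qed.

Lemma eval_bigand v (G : seq (form L)) : eval v (bigand G) = all (eval v) G.
Proof. by elim: G => //= A G ->. Qed.

Lemma eval_cnf v M : eval v M = all (fun c => eval v (form_of_clause c)) M.
Proof. by rewrite /form_of_cnf eval_bigand all_map. Qed.

Lemma eval_clause_notin v y s (c : clause L) :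
  ~~ occ_clause y c ->
  eval (v \o subst_atom y s) (form_of_clause c) = eval v (form_of_clause c).
Proof.
elim: c => //= l c IHc; rewrite negb_or => /andP[l_y c_y].
rewrite -/(form_of_clause c) IHc //; congr (_ || _).
by case: l l_y => [[] p] /= p_y; rewrite subst_atom_notin.
Qed.

Lemma entails_subst y s A B :
  entails A B -> entails (subst_form y s A) (subst_form y s B).
Proof. by move=> AB v; rewrite !eval_subst; apply: AB. Qed.

Lemma entails_remove_free y M : entails M (remove_free y M).
Proof.
move=> v; rewrite !eval_cnf all_filter.
by apply: sub_all => c /= ->; rewrite implybT.
Qed.

(** A clause without [y] keeps its value under the substitution, so [eval v M] already makes every
    deleted clause true. *)
Lemma eval_subst_remove_free v y s M :
  eval v M ->
  eval v (subst_form y s (remove_free y M)) = eval v (subst_form y s M).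
Proof.
rewrite !eval_subst !eval_cnf all_filter => vM.
elim: M vM => //= c M IHM /andP[vc vM]; rewrite IHM //.
by case: (boolP (occ_clause y c)) => //= c_y; rewrite eval_clause_notin // vc.
Qed.

End Evaluation.

Section Complexity.
Variable L : signature.

Lemma clause_complexity_gt0 (c : clause L) : 0 < clause_complexity c.
Proof.
case: c => [|[b [P a]] c]; rewrite /clause_complexity //= big_cons.
by rewrite /literal_complexity /= addnS.
Qed.

(** Strict because every deleted clause, even the empty one, costs at least one symbol, while the
    number of conjunctions does not grow. *)
Lemma cnf_complexity_filter (p : pred (clause L)) (M : cnf L) :
  ~~ all p M -> cnf_complexity (filter p M) < cnf_complexity M.
Proof.
rewrite -has_predC has_count => Mp; rewrite /cnf_complexity -addSn.
apply: leq_add; last by rewrite -!subn1 leq_sub2r // size_filter count_size.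
rewrite big_filter [leqRHS](bigID p) /= -addn1 leq_add2l.
rewrite (leq_trans Mp) // -sum1_count; apply: leq_sum => c _.
exact: clause_complexity_gt0.
Qed.

End Complexity.

Section Solutions.
Variables (L : signature) (x alpha : nat) (F : form L) (U V : seq (term L)).

Local Notation C0 := (canonical_solution x F U).
Local Notation keeps := (keeps_solution x alpha F U V).
Local Notation is_solution := (solution x alpha F U V).

Lemma keeps_solutionP (A : form L) :
  keeps A <->
  forall v, eval v C0 -> ~~ all (fun s => eval v (subst_form alpha s A)) V.
Proof.
rewrite /keeps_solution /valid_sequent /canonical_solution.
split=> keepsA v.
  rewrite eval_bigand => vG; apply/negP => vV.
  by have := keepsA v; rewrite all_cat vG /alpha_instances all_map vV => /(_ isT).
rewrite all_cat /alpha_instances all_map => /andP[vV vG].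
by have := keepsA v; rewrite eval_bigand vG => /(_ isT); rewrite vV.
Qed.

Lemma solutionP (A : form L) : is_solution A <-> entails C0 A /\ keeps A.
Proof.
rewrite keeps_solutionP /solution /valid_sequent /entails /canonical_solution.
split=> [solA | [CA keepsA] v].
  suff solA' v : eval v (bigand (grammar_instances x F U)) ->
      eval v A && ~~ all (fun s => eval v (subst_form alpha s A)) V.
    by split=> v /solA' /andP[].
  rewrite eval_bigand => vG; have := solA v.
  rewrite all_rcons vG andbT /= eval_bigand /alpha_instances all_map.
  (* With Gamma true the implication must be false, so its premise [A] is true and some instance is
     false. *)
  by case: (eval v A) => [/= |/(_ isT) //]; case: (all _ V) => // /(_ isT).
rewrite all_rcons /= => /andP[]; rewrite eval_bigand /alpha_instances all_map.
move=> + vG; rewrite CA ?eval_bigand //= => vV.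
by have := keepsA v; rewrite eval_bigand vG vV => /(_ isT).
Qed.

(** The test can only get harder along a chain of consequences: passing it at the end means passing
    it at every link. *)
Lemma keeps_solution_entails (A B : form L) :
  entails A B -> keeps B -> keeps A.
Proof.
move=> AB /keeps_solutionP keepsB; apply/keeps_solutionP => v /keepsB.
by apply: contraNN; apply: sub_all => s; apply: entails_subst.
Qed.

Lemma solution_remove_free (A : cnf L) :
  is_solution A -> is_solution (remove_free alpha A).
Proof.
move=> /solutionP[CA /keeps_solutionP keepsA]; apply/solutionP; split.
  by move=> v /CA; apply: entails_remove_free.
apply/keeps_solutionP => v vC; apply: contraNN (keepsA v vC).
by apply: sub_all => s; rewrite eval_subst_remove_free //; apply: CA.
Qed.

Lemma minimal_solution_remove_free (M : cnf L) :
  minimal_solution x alpha F U V M -> remove_free alpha M = M.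
Proof.
move=> [solM minM]; apply/all_filterP/negPn/negP => /cnf_complexity_filter.
by rewrite ltnNge minM //; apply: solution_remove_free.
Qed.

Variable gen : cnf L -> set (cnf L).
Hypothesis genP : consequence_generator gen.

(** Entailment by Gamma is inherited through [gen], and the test before each recursive call supplies
    the other half of being a solution. *)
Lemma SF_solution (A : cnf L) (S : set (cnf L)) :
  SF x alpha F U V gen A S -> is_solution A ->
  forall B, S B -> is_solution B.
Proof.
elim=> {}A R _ IH solA B [[->|[B' [genB' keepsB'] RB]] _].
  exact: solution_remove_free.
apply: (IH B') => //; apply/solutionP; split=> // v.
have [CA _] := (solutionP A).1 solA.
by move/CA; apply: (genP A).2.
Qed.

(** The alternative [M = A] is the end of the chain, needed for the induction on calls to reach [M].
    Entailment by [C0] is passed down the chain, while [keeps] is pulled back from [M]. *)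
Lemma SF_generates (M A : cnf L) (S : set (cnf L)) :
  minimal_solution x alpha F U V M -> M = A \/ generates gen M A ->
  entails C0 A -> SF x alpha F U V gen A S -> S M.
Proof.
move=> minM genMA CA SF_A.
have keepsM : keeps M by case: minM => /solutionP[].
have gen_entails B : generates gen M B -> entails B M.
  elim=> [{}B /(genP B).2 //|{}B B' /(genP B).2 BB' _ B'M] v.
  by move/BB'/B'M.
elim: SF_A genMA CA => {S}A R SF_R IH genMA CA.
have keepsA : keeps A.
  case: genMA => [<- //|/gen_entails AM]; exact: keeps_solution_entails keepsM.
(* Minimality comes first: all candidates are solutions, so none is simpler than [M]. Membership of
   [M] remains. *)
split; last first.
  move=> B SB; apply: minM.2.
  case: SB => [->|[B' [genB' keepsB'] RB]].
    by apply/solution_remove_free/solutionP.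
  apply: (SF_solution (SF_R _ genB' keepsB')) RB.
  by apply/solutionP; split=> // v /CA; apply: (genP A).2.
case: genMA => [<-|genMA]; first by left; rewrite /= minimal_solution_remove_free.
(* [B] is the first link of the chain from [A] to [M]; the recursive call on it returns [M]. *)
right; have [B genB MB] : exists2 B, gen A B & M = B \/ generates gen M B.
  case: genMA => [B genM|B B' genB' MB']; first by exists M; [|left].
  by exists B'; [|right].
have keepsB : keeps B.
  by case: MB => [<- //|/gen_entails BM]; apply: keeps_solution_entails keepsM.
by exists B => //; apply: IH => // v /CA; apply: (genP A).2.
Qed.

Lemma SF_terminates (A : cnf L) :
  well_founded_generator gen -> exists S, SF x alpha F U V gen A S.
Proof.
move=> [lt [_ wf_lt lt_gen]].
(* The order compares values of [gen], so the induction runs on the set [gen A], for all [A] with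
   that value. *)
move EX: (gen A) => X; elim: (wf_lt X) A EX => {}X _ IH A EX.
have /choice[R SF_R] B : exists S, gen A B -> SF x alpha F U V gen B S.
  (* Outside [gen A] no call is made, and [set0] is a dummy value that makes [R] total. *)
  have [genB|?] := pselect (gen A B); last by exists set0.
  have [|S SF_B] := IH (gen B) _ B erefl; last by exists S.
  by rewrite -EX; apply: lt_gen.
by eexists; apply: (SF_return (R := R)) => B /SF_R.
Qed.

End Solutions.

Theorem theorem11 (L : signature) (x alpha : nat) (F : form L)
    (U V : seq (term L)) (gen : cnf L -> set (cnf L))
    (x_alpha : x <> alpha)
    (F_x : forall y, occ_form y F -> y = x)
    (U_alpha : forall y, has (occ_term y) U -> y = alpha)
    (V_ground : forall y, ~~ has (occ_term y) V)
    (genP : consequence_generator gen) :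
  (forall C M : cnf L,
     equivalent C (canonical_solution x F U) ->
     minimal_solution x alpha F U V M ->
     complete_wrt x alpha F U V gen C ->
     forall S, SF x alpha F U V gen C S -> S M) /\
  (well_founded_generator gen ->
   forall A : cnf L, exists S, SF x alpha F U V gen A S).
Proof.
split=> [C M C_equiv minM complC S SF_C|wf_gen A]; last exact: SF_terminates.
have CC0 : entails (canonical_solution x F U) C by move=> v; rewrite C_equiv.
have [C0M _] := (solutionP x alpha F U V M).1 minM.1.
(* As a solution, [M] follows from the canonical one, hence from [C], so completeness yields the
   chain. *)
apply: (SF_generates genP minM _ CC0 SF_C); right; apply: complC => // v.
by rewrite C_equiv; apply: C0M.
Qed.
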